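(* Let $M \ge 1$ be an integer, let $d_1,\dots,d_M \ge 1$ be integers, at least one of which is $\ge 2$, and let $\lambda_1,\dots,\lambda_M \in (0,\infty)$. For each integer $n \ge 1$ such that $d_i \mid n$ for every $1 \le i \le M$, equip the finite set $$\Omega = \prod_{i=1}^M \left( \mathbb{Z}/n\mathbb{Z} \times \mathcal{F}_n^{d_i} \right)$$ with the uniform probability measure, and for $1 \le i \le M$ define the random variable $X_i : \Omega \to \mathbb{R}$ by $$X_i\big((x_1,g_1),\dots,(x_M,g_M)\big) = \lambda_i\, \rho(g_i,x_i).$$ Then, as $n \to \infty$ (through integers divisible by all of $d_1,\dots,d_M$, with $M$, the $d_i$ and the $\lambda_i$ fixed), $$\mathbb{E}\left( \min_{1 \le i \le M} X_i \right) \sim \sqrt{\frac{\pi n}{2}} \left( \sum_{i=1}^M \frac{d_i - 1}{\lambda_i^2} \right)^{-1/2}.$$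
   Context: For integers $n, d \ge 1$ with $d \mid n$, $\mathcal{F}_n^d$ denotes the set of all functions $f : \mathbb{Z}/n\mathbb{Z} \to \mathbb{Z}/n\mathbb{Z}$ such that $|f^{-1}\{x\}| \in \{0,d\}$ for every $x \in \mathbb{Z}/n\mathbb{Z}$. For a function $f : X \to X$ on a finite set $X$ and $x \in X$, the rho length of $f$ at $x$ is $\rho(f,x) = |\{ f^j(x) : j \in \mathbb{N} \}|$, where $f^j$ is the $j$-fold composition of $f$ with itself and $\mathbb{N}$ includes $0$ (so $f^0(x) = x$ is in the set). For positive functions $f,g$ of $n$, $f \sim g$ means that $f(n)/g(n) \to 1$ as $n \to \infty$. *)

(* Defs.v *)
From HB Require Import structures.
From mathcomp Require Import all_boot all_order all_algebra.
From mathcomp Require Import boolp reals.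

Set Implicit Arguments.
Unset Strict Implicit.
Unset Printing Implicit Defensive.

Import Order.TTheory GRing.Theory Num.Theory.

(* Z/nZ is represented by its residues 'I_n: only the underlying set matters,
   and 'I_n, unlike 'Z_n, has exactly n elements for every n. *)
Definition Fnd (n d : nat) : {set {ffun 'I_n -> 'I_n}} :=
  [set f : {ffun 'I_n -> 'I_n} |
    [forall x : 'I_n,
      (#|f @^-1: [set x]| == 0%N) || (#|f @^-1: [set x]| == d)]].

Definition rho (T : finType) (f : T -> T) (x : T) : nat :=
  #|[set y : T | `[< exists j : nat, y = iter j f x >]]|.

Lemma rhoE (T : finType) (f : T -> T) (x : T) : rho f x = order f x.
Proof.
rewrite /rho /order; apply: eq_card => y; rewrite inE.
by apply/asboolP/idP => [[j ->]|/iter_findex <-];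
  [exact: fconnect_iter | exists (findex f x y)].
Qed.

Definition Omega (M n : nat) (d : 'I_M -> nat) :
    {set {ffun 'I_M -> 'I_n * {ffun 'I_n -> 'I_n}}} :=
  [set w : {ffun 'I_M -> 'I_n * {ffun 'I_n -> 'I_n}} |
    [forall i : 'I_M, (w i).2 \in Fnd n (d i)]].

Local Open Scope ring_scope.

(* Expectation of X for the uniform probability measure on A. *)
Definition unif_expect (R : realType) (T : finType) (A : {set T})
    (X : T -> R) : R :=
  (\sum_(w in A) X w) / #|A|%:R.

Definition Xvar (R : realType) (M n : nat) (lambda : 'I_M -> R) (i : 'I_M)
    (w : {ffun 'I_M -> 'I_n * {ffun 'I_n -> 'I_n}}) : R :=
  lambda i * (rho (w i).2 (w i).1)%:R.

(* Num.min has no neutral element on R, so the iteration starts from the value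
   at index 0, which exists since 0 < M. *)
Definition min_family (R : realType) (M : nat) (hM : (0 < M)%N)
    (Y : 'I_M -> R) : R :=
  \big[Num.min/Y (Ordinal hM)]_(i < M) Y i.

(* Main.v *)
Require Import Defs.
From HB Require Import structures.
From mathcomp Require Import all_boot all_order all_algebra.
From mathcomp Require Import perm.
From mathcomp Require Import all_classical all_reals all_analysis.
From mathcomp Require Import measurable_realfun.
From mathcomp Require Import ring lra.
Import Order.TTheory GRing.Theory Num.Theory.
Import numFieldNormedType.Exports.

(** The law of a single rho length is explicit. For a uniform point x and a
    uniform map g of the class with fibers of size 0 or d,

      P(rho(g, x) > k) = (1 - k / n) * prod_(j < k) (n - d j) / (n - j).

    Indeed rho(g, x) > k says that x, g x, ..., g^k x are distinct, so it is
    enough to count the maps with k prescribed values g a_j = b_j, where the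
    a_j are distinct and the b_j are distinct. Composing g with permutations on
    either side preserves the class, so this number does not depend on the
    prescription; and a map that already satisfies j prescriptions sends
    exactly n - d j points outside the j prescribed values, because each of
    these values has a full fiber. Hence each prescription multiplies the count
    by (n - d j) / (n - j)^2 ([card_Fnd_through_cons]), and summing over the
    n (n - 1) ... (n - k) injective paths gives [card_rho_gt].

    Each factor is 1 - (d - 1) j / (n - j), so the product behaves like
    exp (- (d - 1) k^2 / (2 n)): with k ~ w sqrt n the tail tends to
    exp (- (d - 1) w^2 / 2) ([survival_cvg]), and when d > 1 it is bounded by a
    Gaussian uniformly in n ([survival_dominated]).

    The coordinates are independent, so the tail of the minimum is the product
    of the tails ([unif_expect_lt_min]). With H = sum_i (d_i - 1) / lambda_i^2
    and the minimum Y divided by sqrt (2 n / H), the product of the limits is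
    exactly exp (- v^2). The expectation of a nonnegative variable is the
    integral of its tail ([unif_expect_layer_cake]), and dominated convergence,
    with the Gaussian bound coming from a coordinate with d_i > 1, gives

      E Y / sqrt (2 n / H) --> int_0^oo exp (- v^2) dv = sqrt pi / 2,

    which is the announced equivalent. *)

Set Implicit Arguments.
Unset Strict Implicit.
Unset Printing Implicit Defensive.

(** * Counting maps with prescribed values *)

(** Division by d is a map whose fibers are the n / d blocks of d consecutive
    residues. *)
Lemma card_Fnd_gt0 (n d : nat) : 0 < d -> d %| n -> 0 < #|Fnd n d|.
Proof.
move=> d0 /dvdnP[m ->{n}].
have lt_div (x : 'I_(m * d)) : x %/ d < m * d.
  by apply: leq_ltn_trans (leq_div _ _) (ltn_ord x).
apply/card_gt0P; exists [ffun x => Ordinal (lt_div x)].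
rewrite inE; apply/forallP => y.
have [ym|my] := ltnP y m; last first.
  apply/orP; left; rewrite cards_eq0; apply/eqP/setP => x.
  rewrite !inE ffunE; apply/negbTE/eqP => /(congr1 val) /= xy.
  by move: my; rewrite -xy leqNgt ltn_divLR// ltn_ord.
apply/orP; right; apply/eqP.
have ltyj (j : 'I_d) : y * d + j < m * d.
  by apply: (@leq_trans (y * d + d)); rewrite ?ltn_add2l// -mulSnr leq_pmul2r.
have injh : injective (fun j => Ordinal (ltyj j)).
  by move=> i j [] /addnI/val_inj.
rewrite -[RHS]card_ord -cardsT -(card_imset _ injh); apply: eq_card => x.
rewrite !inE ffunE; apply/eqP/imsetP => [[xy]|[j _ ->]]; last first.
  by apply/val_inj; rewrite /= divnMDl// divn_small ?addn0.
exists (Ordinal (ltn_pmod x d0)) => //.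
by apply/val_inj; rewrite /= -xy -divn_eq.
Qed.

(** Every point of B is attained, so its fiber has d elements and not 0. *)
Lemma card_Fnd_preim (n d : nat) (f : {ffun 'I_n -> 'I_n}) (B : {set 'I_n}) :
  f \in Fnd n d -> {subset B <= codom f} ->
  #|[set x | f x \notin B]| = n - d * #|B|.
Proof.
rewrite inE => /forallP fF sB.
have -> : [set x | f x \notin B] = ~: (f @^-1: B) by apply/setP => x; rewrite !inE.
rewrite cardsCs finset.setCK card_ord; congr (_ - _).
rewrite -sum1_card (partition_big f (mem B)) /=; last by move=> x; rewrite inE.
rewrite (eq_bigr (fun=> d)) ?sum_nat_const 1?mulnC// => b bB.
have /codomP[x fx] := sB _ bB.
have /orP[|/eqP <-] := fF b.
  by rewrite cards_eq0 => /eqP/setP/(_ x); rewrite !inE fx eqxx.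
rewrite -sum1_card; apply: eq_bigl => y; rewrite !inE.
by case: eqP => [->|]; rewrite ?bB ?andbF.
Qed.

Definition Fnd_through (n d : nat) (s : seq ('I_n * 'I_n)) :=
  [set f in Fnd n d | all (fun p => f p.1 == p.2) s].

(** The involution of the class given by the transpositions of a, a' before the
    map and of b, b' after it leaves the prescriptions of s alone and
    exchanges the two extra ones. The inequality gives the equality, its
    hypotheses being symmetric. *)
Lemma card_Fnd_through_cons_tperm (n d : nat) (s : seq ('I_n * 'I_n))
    (a b a' b' : 'I_n) :
  a \notin unzip1 s -> b \notin unzip2 s ->
  a' \notin unzip1 s -> b' \notin unzip2 s ->
  #|Fnd_through d ((a, b) :: s)| <= #|Fnd_through d ((a', b') :: s)|.
Proof.
move=> as1 bs2 a's1 b's2.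
pose h (f : {ffun 'I_n -> 'I_n}) := [ffun x => tperm b b' (f (tperm a a' x))].
have hK : involutive h.
  by move=> f; apply/ffunP => x; rewrite !ffunE !tpermK.
rewrite -(card_imset _ (inv_inj hK)); apply/subset_leq_card/fintype.subsetP => _
  /imsetP[f + ->]; rewrite !inE /= => /andP[/forallP fF /andP[/eqP fab /allP fs]].
apply/andP; split.
  apply/forallP => y.
  suff -> : h f @^-1: [set y] = tperm a a' @: (f @^-1: [set tperm b b' y]).
    by rewrite (card_imset _ perm_inj); exact: fF.
  apply/setP => x; rewrite !inE ffunE -(inj_eq (@perm_inj _ (tperm b b'))) tpermK.
  apply/idP/imsetP => [fx|[z + ->]]; last by rewrite tpermK !inE.
  by exists (tperm a a' x); rewrite ?tpermK // !inE.
rewrite ffunE tpermR fab tpermL eqxx /=; apply/allP => -[u v] uvs /=.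
have us1 : u \in unzip1 s by apply/mapP; exists (u, v).
have vs2 : v \in unzip2 s by apply/mapP; exists (u, v).
have neq (z z' : 'I_n) (t : seq 'I_n) : z \notin t -> z' \in t -> z != z'.
  by move=> + z't; apply: contraNneq => ->.
have /eqP /= fuv := fs _ uvs.
by rewrite ffunE (tpermD (z := u)) ?(neq _ _ _ _ us1)// fuv tpermD ?(neq _ _ _ _ vs2).
Qed.

(** Double counting of the triples (f, a', b') where f meets the prescriptions
    of s, f a' = b', and a', b' are fresh: the number of f is the same for each
    of the (n - size s)^2 fresh pairs, while each f has n - d * size s points
    with a fresh image. *)
Lemma card_Fnd_through_cons (n d : nat) (s : seq ('I_n * 'I_n)) (a b : 'I_n) :
  uniq (unzip1 ((a, b) :: s)) -> uniq (unzip2 ((a, b) :: s)) ->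
  #|Fnd_through d ((a, b) :: s)| * (n - size s) ^ 2 =
  #|Fnd_through d s| * (n - d * size s).
Proof.
move=> /= /andP[as1 us1] /andP[bs2 us2].
pose A := [set x | x \notin unzip1 s]; pose B := [set y | y \notin unzip2 s].
have cardC (t : seq 'I_n) : uniq t -> #|[set x | x \notin t]| = n - size t.
  move=> ut; rewrite cardsCs card_ord -(card_uniqP ut); congr (_ - _).
  by apply: eq_card => x; rewrite !inE negbK.
transitivity (\sum_(f in Fnd_through d s) #|[set x | f x \in B]|); last first.
  rewrite -sum_nat_const; apply: eq_bigr => f; rewrite inE => /andP[fF /allP fs].
  have -> : [set x | f x \in B] = [set x | f x \notin [set y in unzip2 s]].
    by apply/setP => x; rewrite !inE.
  rewrite (card_Fnd_preim fF) ?cardsE ?(card_uniqP us2) ?size_map// => y.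
  by rewrite inE => /mapP[p /fs/eqP fp ->]; apply/codomP; exists p.1.
transitivity (\sum_(a' in A) \sum_(b' in B) #|Fnd_through d ((a', b') :: s)|).
  rewrite (eq_bigr (fun=> #|B| * #|Fnd_through d ((a, b) :: s)|)); last first.
    move=> a'; rewrite inE => a's1; rewrite -sum_nat_const; apply: eq_bigr => b'.
    rewrite inE => b's2; apply/eqP; rewrite eqn_leq.
    by rewrite !card_Fnd_through_cons_tperm.
  by rewrite sum_nat_const !cardC// !size_map mulnA mulnC.
have cardE a' b' :
    #|Fnd_through d ((a', b') :: s)| = \sum_(f in Fnd_through d s) (f a' == b').
  rewrite -sum1_card big_mkcond [RHS]big_mkcond; apply: eq_bigr => f _.
  by rewrite !inE /=; case: (f a' == b'); rewrite ?andbF //=; case: ifP.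
under eq_bigr do under eq_bigr do rewrite cardE.
under eq_bigr do rewrite exchange_big.
rewrite exchange_big /=; apply: eq_bigr => f; rewrite inE => /andP[_ /allP fs].
rewrite -sum1_card big_mkcond [RHS]big_mkcond; apply: eq_bigr => x _.
transitivity (if x \in A then (f x \in B : nat) else 0).
  case: ifP => // _; have [fxB|fxB] := boolP (f x \in B).
    rewrite (bigD1 (f x)) //= eqxx big1 ?addn0// => b' /andP[_].
    by rewrite eq_sym => /negbTE ->.
  by rewrite big1// => b' b'B; case: eqP fxB => // ->; rewrite b'B.
(* A point that is not fresh has its image among the prescribed values. *)
rewrite !inE; case: ifPn => [_|]; first by case: ifP.
rewrite negbK => /mapP[p ps ->].
by rewrite (eqP (fs _ ps)) (map_f snd ps).
Qed.

Lemma card_Fnd_through_prod (n d : nat) (s : seq ('I_n * 'I_n)) :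
  uniq (unzip1 s) -> uniq (unzip2 s) ->
  #|Fnd_through d s| * \prod_(j < size s) (n - j) ^ 2 =
  #|Fnd n d| * \prod_(j < size s) (n - d * j).
Proof.
elim: s => [_ _|[a b] s IHs us1 us2].
  rewrite !big_ord0 !muln1; congr #|pred_of_set _|.
  by apply/setP => f; rewrite inE andbT.
have /= /andP[_ us1'] := us1; have /= /andP[_ us2'] := us2.
rewrite /= !big_ord_recr /= mulnA mulnAC (card_Fnd_through_cons _ us1 us2).
by rewrite mulnAC IHs// mulnA.
Qed.

Lemma gt_orderE (T : finType) (f : T -> T) (x : T) (k : nat) :
  (k < order f x) = uniq (traject f x k.+1).
Proof.
apply/idP/idP => [kx|].
  have := orbit_uniq f x; rewrite /orbit -(subnKC kx) trajectD cat_uniq.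
  by case/andP.
move/card_uniqP; rewrite size_traject => <-; apply: subset_leq_card.
by apply/fintype.subsetP=> _ /trajectP[i _ ->]; apply: fconnect_iter.
Qed.

Lemma all_zip_traject (T : eqType) (f : T -> T) (x : T) (s : seq T) :
  all (fun p => f p.1 == p.2) (zip (x :: s) s)
  = (x :: s == traject f x (size s).+1).
Proof.
elim: s x => [|y s IHs] x; first by rewrite /= eqxx.
rewrite [LHS]/= IHs trajectS [size _]/= !eqseq_cons eqxx /=.
by have [->|] := eqVneq y (f x); rewrite ?eqxx // eq_sym => /negbTE ->.
Qed.

Lemma unzip1_zip_cons (T : Type) (x : T) (s : seq T) :
  unzip1 (zip (x :: s) s) = belast x s.
Proof. by elim: s x => //= y s IHs x; rewrite IHs. Qed.

(** The pairs are sorted by the path x, g x, ..., g^k x, which runs over the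
    injective (k + 1)-tuples; a path t prescribes the k values sending each
    entry of t to the next one. *)
Lemma card_rho_gt (n d k : nat) :
  #|[set p : 'I_n * {ffun 'I_n -> 'I_n} |
      (p.2 \in Fnd n d) && (k < rho p.2 p.1)]|
    * \prod_(j < k) (n - j) ^ 2 =
  #|Fnd n d| * n ^_ k.+1 * \prod_(j < k) (n - d * j).
Proof.
pose through (t : k.+1.-tuple 'I_n) := Fnd_through d (zip t (behead t)).
pose orbit_path (p : 'I_n * {ffun 'I_n -> 'I_n}) : k.+1.-tuple 'I_n :=
  Tuple (introT eqP (size_traject p.2 p.1 k.+1)).
have -> : #|[set p : 'I_n * {ffun 'I_n -> 'I_n} |
              (p.2 \in Fnd n d) && (k < rho p.2 p.1)]|
    = \sum_(t in [set t : k.+1.-tuple 'I_n | all predT t & uniq t]) #|through t|.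
  rewrite -sum1_card (partition_big orbit_path
    (mem [set t : k.+1.-tuple 'I_n | all predT t & uniq t])) /=; last first.
    move=> p; rewrite !inE all_predT rhoE gt_orderE => /andP[_]; exact.
  apply: eq_bigr => t t_uniq; rewrite sum1_card.
  have pair_inj : injective (fun f : {ffun 'I_n -> 'I_n} => (thead t, f)).
    by move=> f g [].
  rewrite -(card_imset _ pair_inj); apply: eq_card => -[x f].
  move: t_uniq; rewrite !inE all_predT /= => ut.
  have throughE : (f \in through t)
      = (f \in Fnd n d) && (val t == traject f (thead t) k.+1).
    rewrite inE; congr (_ && _); case/tupleP: t {ut pair_inj} => y t.
    by rewrite theadE /= all_zip_traject size_tuple.
  rewrite [LHS]unfold_in /= inE /= rhoE gt_orderE.
  apply/idP/imsetP => [/andP[/andP[fF _] /eqP tE]|[g + [-> fg]]].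
    by exists f; rewrite ?throughE ?fF -tE//= eqxx.
  rewrite -fg throughE => /andP[fF /eqP tE].
  by rewrite fF -tE ut -val_eqE [val (orbit_path _)]/= -[_ :: _]tE eqxx.
transitivity (\sum_(t in [set t : k.+1.-tuple 'I_n | all predT t & uniq t])
   (#|Fnd n d| * \prod_(j < k) (n - d * j))).
  rewrite big_distrl; apply: eq_bigr => t; rewrite inE all_predT /= => ut.
  have sz : size (zip t (behead t)) = k.
    by rewrite size_zip size_behead size_tuple (minn_idPr (leqnSn k)).
  have unz2 : unzip2 (zip t (behead t)) = behead t.
    by rewrite unzip2_zip// size_behead leq_pred.
  have := @card_Fnd_through_prod n d (zip t (behead t)).
  rewrite sz unz2; apply.
    case/tupleP: t ut {sz unz2} => y t; rewrite unzip1_zip_cons.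
    by rewrite [tval _]lastI rcons_uniq => /andP[].
  by case/tupleP: t ut {sz unz2} => y t /= /andP[].
rewrite sum_nat_const card_uniq_tuples card_ord.
by rewrite mulnCA mulnA.
Qed.

Local Open Scope classical_set_scope.
Local Open Scope ring_scope.

(** * The tail of one rho length *)

(** For n > 0 a multiple of d > 0, this is P(rho > k), by
    [card_rho_gt_survival]. The subtractions are truncated, so that the formula
    is 0 for k >= n and as soon as a factor n - d j would be negative. *)
Definition survival (R : realType) (n d k : nat) : R :=
  (n - k)%N%:R / n%:R * \prod_(j < k) ((n - d * j)%N%:R / (n - j)%N%:R).

Lemma card_rho_gt_survival (R : realType) (n d k : nat) : (0 < n)%N ->
  #|[set p : 'I_n * {ffun 'I_n -> 'I_n} |
      (p.2 \in Fnd n d) && (k < rho p.2 p.1)%N]%SET|%:R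
  = survival R n d k * (n * #|Fnd n d|)%:R.
Proof.
move=> n0; have [kn|nk] := ltnP k n; last first.
  rewrite /survival (eqP (_ : n - k == 0)%N) ?subn_eq0// !mul0r.
  rewrite (eq_card0 (A := [set _ | _]%SET)) // => p; rewrite !inE ltnNge.
  by rewrite rhoE (leq_trans (max_card _)) ?card_ord ?andbF.
have nR : n%:R != 0 :> R by rewrite pnatr_eq0 -lt0n.
pose P : R := \prod_(j < k) (n - j)%N%:R.
have P0 : P != 0.
  apply/prodf_neq0 => j _; rewrite pnatr_eq0 subn_eq0 -ltnNge.
  exact: ltn_trans kn.
have /(congr1 (fun m => m%:R : R)) := card_rho_gt n d k.
have -> : (n ^_ k.+1 = (n - k) * \prod_(j < k) (n - j))%N.
  by rewrite ffactnSr mulnC ffact_prod.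
rewrite !natrM !natr_prod -/P.
have -> : \prod_(j < k) ((n - j) ^ 2)%N%:R = P ^+ 2 :> R.
  by rewrite /P -prodrXl; apply: eq_bigr => j _; rewrite natrX.
move=> E; apply: (mulIf (expf_neq0 2 P0)); rewrite E.
rewrite /survival prodf_div -/P; field.
by rewrite nR P0.
Qed.

Lemma survival_ge0 (R : realType) (n d k : nat) : 0 <= survival R n d k.
Proof.
by rewrite mulr_ge0 ?divr_ge0// prodr_ge0// => j _; rewrite divr_ge0.
Qed.

(** The factor is 1 - (d - 1) j / (n - j) when it is not 0. *)
Lemma ratio_le_expR (R : realType) (n d j : nat) : (0 < d)%N -> (0 < n)%N ->
  (n - d * j)%N%:R / (n - j)%N%:R <= expR (- ((d%:R - 1) * j%:R / n%:R)) :> R.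
Proof.
move=> d0 n0; have [ndj|djn] := leqP n (d * j).
  by rewrite (eqP (_ : n - d * j == 0)%N) ?subn_eq0// mul0r expR_ge0.
have jdj : (j <= d * j)%N by rewrite leq_pmull.
have jn := leq_ltn_trans jdj djn.
rewrite !natrB ?(ltnW jn) ?(ltnW djn)// natrM.
have njR : 0 < n%:R - j%:R :> R by rewrite subr_gt0 ltr_nat.
have nR : 0 < n%:R :> R by rewrite ltr0n.
have dR : 1 <= d%:R :> R by rewrite ler1n.
apply: le_trans (expR_ge1Dx _).
have -> : (n%:R - d%:R * j%:R) / (n%:R - j%:R) =
    1 - (d%:R - 1) * j%:R / (n%:R - j%:R) :> R.
  by field; rewrite lt0r_neq0.
rewrite lerD2l lerN2 ler_wpM2l//; first by rewrite mulr_ge0// subr_ge0.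
by rewrite lef_pV2 ?posrE// gerBl.
Qed.

Lemma survival_le_expR (R : realType) (n d k : nat) : (0 < d)%N -> (0 < n)%N ->
  survival R n d k <= expR (- ((d%:R - 1) * (k%:R * (k%:R - 1)) / (2 * n%:R))).
Proof.
move=> d0 n0; have nR : 0 < n%:R :> R by rewrite ltr0n.
rewrite /survival -[leRHS]mul1r ler_pM//.
- by rewrite prodr_ge0// => j _; rewrite divr_ge0.
- by rewrite ler_pdivrMr// mul1r ler_nat leq_subr.
elim: k => [|k IHk]; first by rewrite big_ord0 !(mul0r, mulr0) oppr0 expR0.
rewrite big_ord_recr /=.
have -> : - ((d%:R - 1) * (k.+1%:R * (k.+1%:R - 1)) / (2 * n%:R)) =
    - ((d%:R - 1) * (k%:R * (k%:R - 1)) / (2 * n%:R)) + - ((d%:R - 1) * k%:R / n%:R) :> R.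
  by rewrite -natr1; field; rewrite lt0r_neq0.
rewrite expRD ler_pM//.
  by rewrite prodr_ge0// => j _; rewrite divr_ge0.
exact: ratio_le_expR.
Qed.

Lemma natr_mul_pred_ge0 (R : realType) (k : nat) : 0 <= k%:R * (k%:R - 1) :> R.
Proof. by case: k => [|k]; rewrite ?mul0r// mulr_ge0// subr_ge0 ler1n. Qed.

Lemma survival_le1 (R : realType) (n d k : nat) : (0 < d)%N -> (0 < n)%N ->
  survival R n d k <= 1.
Proof.
move=> d0 n0; apply: le_trans (survival_le_expR _ _ d0 n0) _.
rewrite -[leRHS]expR0 ler_expR oppr_le0 divr_ge0// mulr_ge0 ?natr_mul_pred_ge0//.
by rewrite subr_ge0 ler1n.
Qed.

(** The inverse of the factor is 1 + (d - 1) j / (n - d j); bounding n - d j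
    below by n - d k gives exponents that sum in closed form over j < k. *)
Lemma ratio_ge_expR (R : realType) (n d j k : nat) :
  (0 < d)%N -> (j <= k)%N -> (d * k < n)%N ->
  expR (- ((d%:R - 1) * j%:R / (n%:R - d%:R * k%:R)))
    <= (n - d * j)%N%:R / (n - j)%N%:R :> R.
Proof.
move=> d0 jk dkn; have djk : (d * j <= d * k)%N by rewrite leq_mul2l jk orbT.
have djn := leq_ltn_trans djk dkn.
have jn : (j < n)%N by apply: leq_ltn_trans djn; rewrite leq_pmull.
have [dkR djR] : 0 < n%:R - d%:R * k%:R :> R /\ 0 < n%:R - d%:R * j%:R :> R.
  by rewrite -!natrM !subr_gt0 !ltr_nat.
have njR : 0 < n%:R - j%:R :> R by rewrite subr_gt0 ltr_nat.
have dR : 1 <= d%:R :> R by rewrite ler1n.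
rewrite !natrB ?(ltnW jn) ?(ltnW djn)// natrM expRN -[leRHS]invrK invf_div.
rewrite lef_pV2 ?posrE ?expR_gt0 ?divr_gt0//.
apply: le_trans (expR_ge1Dx _).
have -> : (n%:R - j%:R) / (n%:R - d%:R * j%:R) =
    1 + (d%:R - 1) * j%:R / (n%:R - d%:R * j%:R) :> R.
  by field; rewrite lt0r_neq0.
rewrite lerD2l ler_wpM2l//; first by rewrite mulr_ge0// subr_ge0.
by rewrite lef_pV2 ?posrE// lerD2l lerN2 -!natrM ler_nat.
Qed.

Lemma survival_ge_expR (R : realType) (n d k : nat) : (0 < d)%N -> (d * k < n)%N ->
  (1 - k%:R / n%:R)
    * expR (- ((d%:R - 1) * (k%:R * (k%:R - 1)) / (2 * (n%:R - d%:R * k%:R))))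
  <= survival R n d k.
Proof.
move=> d0 dkn; have kn : (k < n)%N by apply: leq_ltn_trans dkn; rewrite leq_pmull.
have nR : 0 < n%:R :> R by rewrite ltr0n; exact: leq_ltn_trans kn.
have dkR : 0 < n%:R - d%:R * k%:R :> R by rewrite -!natrM !subr_gt0 !ltr_nat.
have k1 : 0 <= 1 - k%:R / n%:R :> R.
  by rewrite subr_ge0 ler_pdivrMr// mul1r ler_nat ltnW.
rewrite /survival natrB ?(ltnW kn)// [(n%:R - _) / _]mulrBl divff ?lt0r_neq0// ler_wpM2l//.
(* The induction is on the number m of factors, with the denominators fixed
   at n - d k. *)
suff H m : (m <= k)%N ->
    expR (- ((d%:R - 1) * (m%:R * (m%:R - 1)) / (2 * (n%:R - d%:R * k%:R)))) <=
    \prod_(j < m) ((n - d * j)%N%:R / (n - j)%N%:R) :> R by exact: H.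
elim: m => [_|m IHm mk]; first by rewrite big_ord0 !(mul0r, mulr0) oppr0 expR0.
rewrite big_ord_recr /=.
have -> : - ((d%:R - 1) * (m.+1%:R * (m.+1%:R - 1)) / (2 * (n%:R - d%:R * k%:R))) =
    - ((d%:R - 1) * (m%:R * (m%:R - 1)) / (2 * (n%:R - d%:R * k%:R)))
    + - ((d%:R - 1) * m%:R / (n%:R - d%:R * k%:R)) :> R.
  by rewrite -natr1; field; rewrite lt0r_neq0.
by rewrite expRD ler_pM ?expR_ge0 ?IHm ?(ltnW mk)// ratio_ge_expR// ltnW.
Qed.

Lemma cvg_sqrt_natV (R : realType) : (Num.sqrt n%:R)^-1 @[n --> \oo] --> (0 : R).
Proof.
rewrite -(@cvg_shiftS R) /=.
have -> : (fun n => (Num.sqrt n.+1%:R)^-1) = (fun n => Num.sqrt (harmonic n)) :> (nat -> R).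
  by apply/funext => n; rewrite /harmonic sqrtrV.
have : Num.sqrt (harmonic n) @[n --> \oo] --> (Num.sqrt 0 : R).
  by apply: continuous_cvg; [exact: sqrt_continuous|exact: cvg_harmonic].
by rewrite sqrtr0.
Qed.

Lemma cvg_truncn_sqrt (R : realType) (w : R) : 0 <= w ->
  (Num.truncn (w * Num.sqrt n%:R))%:R / Num.sqrt n%:R @[n --> \oo] --> w.
Proof.
move=> w0.
have sn0 : w - (Num.sqrt n%:R)^-1 @[n --> \oo] --> w.
  by have := cvgB (cvg_cst w) (@cvg_sqrt_natV R); rewrite subr0; apply.
apply: (squeeze_cvgr _ sn0 (cvg_cst w)); near=> n.
have n0 : 0 < Num.sqrt n%:R :> R.
  by rewrite sqrtr_gt0 ltr0n; near: n; exact: nbhs_infty_gt.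
have /andP[lew ltw] := truncn_itv (mulr_ge0 w0 (ltW n0)).
rewrite ler_pdivrMr// lew andbT ler_pdivlMr// mulrBl mulVf ?lt0r_neq0//.
by rewrite lerBlDr natr1 ltW.
Unshelve. all: by end_near. Qed.

(** The two bounds in the variables s = 1 / sqrt n and r = k / sqrt n, which
    have limits as n grows. *)
Lemma survival_bounds (R : realType) (n d k : nat) (r s : R) :
  (0 < d)%N -> (0 < n)%N -> s != 0 -> n%:R = (s ^+ 2)^-1 -> k%:R = r / s ->
  0 < 1 - d%:R * (r * s) ->
  (1 - r * s)
      * expR (- ((d%:R - 1) * (r * (r - s)) / (2 * (1 - d%:R * (r * s)))))
    <= survival R n d k <= expR (- ((d%:R - 1) * (r * (r - s)) / 2)).
Proof.
move=> d0 n0 s0 nE kE drs.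
have dkn : (d * k < n)%N.
  rewrite -(ltr_nat R) natrM kE nE -[ltRHS]mul1r ltr_pdivlMr ?exprn_even_gt0//.
  have -> : d%:R * (r / s) * s ^+ 2 = d%:R * (r * s) by field.
  by rewrite -subr_gt0.
have -> : 1 - r * s = 1 - k%:R / n%:R by rewrite kE nE; field.
have -> : (d%:R - 1) * (r * (r - s)) / (2 * (1 - d%:R * (r * s))) =
    (d%:R - 1) * (k%:R * (k%:R - 1)) / (2 * (n%:R - d%:R * k%:R)).
  rewrite kE nE.
  have -> : (s ^+ 2)^-1 - d%:R * (r / s) = (1 - d%:R * (r * s)) / s ^+ 2 by field.
  by field; rewrite s0 lt0r_neq0.
have -> : (d%:R - 1) * (r * (r - s)) / 2 =
    (d%:R - 1) * (k%:R * (k%:R - 1)) / (2 * n%:R).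
  by rewrite kE nE; field.
by rewrite survival_ge_expR// survival_le_expR.
Qed.

Lemma survival_cvg (R : realType) (d : nat) (w : R) : (0 < d)%N -> 0 <= w ->
  survival R n d (Num.truncn (w * Num.sqrt n%:R)) @[n --> \oo]
    --> expR (- ((d%:R - 1) * w ^+ 2 / 2)).
Proof.
move=> d0 w0.
pose s n : R := (Num.sqrt n%:R)^-1.
pose k n := Num.truncn (w * Num.sqrt n%:R : R).
pose r n : R := (k n)%:R * s n.
have s0 : s n @[n --> \oo] --> (0 : R) := @cvg_sqrt_natV R.
have rw : r n @[n --> \oo] --> w := cvg_truncn_sqrt w0.
have rs0 : r n * s n @[n --> \oo] --> (0 : R).
  by have := cvgM rw s0; rewrite mulr0; apply.
have drs1 : 1 - d%:R * (r n * s n) @[n --> \oo] --> (1 : R).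
  have := cvgB (cvg_cst (1 : R)) (cvgM (cvg_cst (d%:R : R)) rs0).
  by rewrite mulr0 subr0; apply.
have num : (d%:R - 1) * (r n * (r n - s n)) @[n --> \oo] --> (d%:R - 1) * w ^+ 2.
  apply: cvgMl_tmp; rewrite expr2; apply: cvgM => //.
  by have := cvgB rw s0; rewrite subr0; apply.
have den : 2 * (1 - d%:R * (r n * s n)) @[n --> \oo] --> (2 : R).
  by have := cvgM (cvg_cst (2 : R)) drs1; rewrite mulr1; apply.
have expR_cvg (u : nat -> R) (l : R) : u n @[n --> \oo] --> l ->
    expR (- u n) @[n --> \oo] --> expR (- l).
  by move=> ul; apply: continuous_cvg; [exact: continuous_expR|exact: cvgN].
have two0 : 2 != 0 :> R by rewrite pnatr_eq0.
have upper : expR (- ((d%:R - 1) * (r n * (r n - s n)) / 2)) @[n --> \oo]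
    --> expR (- ((d%:R - 1) * w ^+ 2 / 2)).
  by apply: expR_cvg; exact: cvgMr_tmp.
have lower : (1 - r n * s n)
    * expR (- ((d%:R - 1) * (r n * (r n - s n)) / (2 * (1 - d%:R * (r n * s n))))) @[n --> \oo]
    --> expR (- ((d%:R - 1) * w ^+ 2 / 2)).
  have := cvgM (cvgB (cvg_cst (1 : R)) rs0)
    (expR_cvg _ _ (cvgM num (cvgV two0 den))).
  by rewrite subr0 mul1r; apply.
apply: (squeeze_cvgr _ lower upper); near=> n.
have n0 : (0 < n)%N by near: n; exact: nbhs_infty_gt.
have sq0 : 0 < Num.sqrt n%:R :> R by rewrite sqrtr_gt0 ltr0n.
have nE : n%:R = (s n ^+ 2)^-1 by rewrite /s exprVn sqr_sqrtr// invrK.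
have sn0 : s n != 0 by rewrite invr_eq0 lt0r_neq0.
have kE : (k n)%:R = r n / s n by rewrite /r mulfK.
have drs : 0 < 1 - d%:R * (r n * s n).
  by near: n; exact: (cvgr_gt _ drs1 _ ltr01).
exact: survival_bounds.
Unshelve. all: by end_near. Qed.

(** One tail with d > 1 is enough to dominate the tail of the minimum. *)
Lemma survival_dominated (R : realType) (n d : nat) (w : R) :
  (1 < d)%N -> (0 < n)%N -> 0 <= w ->
  survival R n d (Num.truncn (w * Num.sqrt n%:R)) <= expR (5 / 4 - w ^+ 2 / 4).
Proof.
move=> d1 n0 w0; have nR : 1 <= n%:R :> R by rewrite ler1n.
have nR0 : 0 < n%:R :> R by apply: lt_le_trans nR.
apply: le_trans (survival_le_expR _ _ (ltnW d1) n0) _.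
rewrite ler_expR.
have := truncnS_gt (w * Num.sqrt n%:R); rewrite -natr1.
set k := Num.truncn _ => vk.
have kk := natr_mul_pred_ge0 R k.
have v2 : (w * Num.sqrt n%:R) ^+ 2 = w ^+ 2 * n%:R by rewrite exprMn sqr_sqrtr// ltW.
(* Since w sqrt n < k + 1, this follows from k (k - 1) >=
   (k + 1)^2 / 2 - 5 / 2, a rewriting of (k - 2)^2 >= 0. *)
have lb : w ^+ 2 * n%:R / 2 - 5 / 2 <= k%:R * (k%:R - 1).
  rewrite -v2; have : (w * Num.sqrt n%:R) ^+ 2 <= (k%:R + 1) ^+ 2.
    by rewrite lerXn2r ?nnegrE ?mulr_ge0 ?sqrtr_ge0 ?addr_ge0// ltW.
  move: ((w * _) ^+ 2) => v.
  have := sqr_ge0 (k%:R - 2 : R).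
  nra.
have d2 : 2 <= d%:R :> R by rewrite ler_nat.
have : k%:R * (k%:R - 1) <= (d%:R - 1) * (k%:R * (k%:R - 1)) :> R.
  apply: ler_peMl => //; move: d2; lra.
set e : R := (d%:R - 1) * (k%:R * (k%:R - 1)); move=> le_e.
have : (w ^+ 2 * n%:R / 2 - 5 / 2) / (2 * n%:R) <= e / (2 * n%:R).
  by rewrite ler_pM2r ?invr_gt0 ?mulr_gt0//; exact: le_trans le_e.
have -> : (w ^+ 2 * n%:R / 2 - 5 / 2) / (2 * n%:R) = w ^+ 2 / 4 - 5 / 4 / n%:R.
  by field; rewrite lt0r_neq0.
have : 5 / 4 / n%:R <= 5 / 4 :> R by rewrite ler_pdivrMr// ler_peMr ?divr_ge0.
by move: (5 / 4 / _) (e / _) => x y; lra.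
Qed.

(** * Expectations as integrals of tails *)

(** Up to a constant this is the density of a centered normal law of variance
    1 / (2 b). *)
Lemma integrable_gaussian (R : realType) (a b : R) : 0 < b ->
  (@lebesgue_measure R).-integrable setT (fun x => (expR (a - b * x ^+ 2))%:E).
Proof.
move=> b0; pose sigma := Num.sqrt (2 * b)^-1.
have s0 : 0 < sigma by rewrite sqrtr_gt0 invr_gt0 mulr_gt0.
have sE : sigma ^+ 2 = (2 * b)^-1 by rewrite sqr_sqrtr// invr_ge0 mulr_ge0// ltW.
have -> : (fun x => (expR (a - b * x ^+ 2))%:E) =
    (fun x => (expR a / normal_peak sigma)%:E * (normal_pdf 0 sigma x)%:E)%E.
  apply/funext => x; rewrite -EFinM normal_pdfE ?lt0r_neq0// /= /normal_fun.
  rewrite [expR a / _ * _]mulrA divfK ?lt0r_neq0 ?normal_peak_gt0 ?lt0r_neq0// -expRD.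
  congr (expR (_ + _))%:E; rewrite subr0 sE; field; exact: lt0r_neq0.
by apply: integrableZl => //; exact: integrable_normal_pdf.
Qed.

Lemma measurable_indicator_lt (R : realType) (c : R) :
  measurable_fun [set: R] (fun v : R => (v < c)%R%:R : R).
Proof.
rewrite (_ : (fun v => _) = \1_[set` `]-oo, c[])//.
by apply/funext => v; rewrite indicE mem_setE in_itv.
Qed.

(** X w is the length of the interval of the v >= 0 with v < X w; the sum over
    w is finite, so it commutes with the integral. *)
Lemma unif_expect_layer_cake (R : realType) (T : finType) (A : {set T}) (X : T -> R) :
  (forall w, 0 <= X w) ->
  (\int[lebesgue_measure]_(v in `[0%R, +oo[) (unif_expect A (fun w => (v < X w)%R%:R))%:E
   = (unif_expect A X)%:E)%E.
Proof.
move=> X0; rewrite /unif_expect.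
under eq_integral do rewrite EFinM -sumEFin -big_enum /=.
have meas w : measurable_fun (`[0%R, +oo[ : set R) (EFin \o (fun v : R => (v < X w)%R%:R : R)).
  by apply/measurable_EFinP; apply: measurable_funS (measurable_indicator_lt _).
have ge0 w (v : R) : (0 <= (v < X w)%R%:R%:E :> \bar R)%E by rewrite lee_fin.
rewrite ge0_integralZr//=; last 2 first.
- exact: emeasurable_sum.
- by move=> v _; rewrite sume_ge0.
rewrite ge0_integral_sum// EFinM -sumEFin -[in RHS]big_enum /=; congr (_ * _)%E.
apply: eq_bigr => w _.
transitivity (\int[lebesgue_measure]_(v in `[0%R, +oo[) (\1_[set` `[0%R, X w[] v)%:E)%E.
  apply: eq_integral => v; rewrite inE /= in_itv /= andbT => v0.
  by rewrite indicE mem_setE in_itv /= v0.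
rewrite integral_indic// setIidl.
  apply: etrans (lebesgue_measure_itv `[0, X w[) _ => /=.
  by rewrite lte_fin; case: ltgtP (X0 w) => // [_|<-]; rewrite ?sube0.
by move=> v /=; rewrite !in_itv /= andbT => /andP[].
Qed.

Lemma card_ffun_forall (I T : finType) (P : I -> pred T) :
  #|[set w : {ffun I -> T} | [forall i, P i (w i)]]%SET| = (\prod_i #|P i|)%N.
Proof.
transitivity #|family P|; last by rewrite card_family foldrE big_map big_enum.
apply: eq_card => w; rewrite inE; exact/forallP/familyP.
Qed.

Lemma lt_min_family (R : realType) (M : nat) (hM : (0 < M)%N) (Y : 'I_M -> R) (t : R) :
  (t < min_family hM Y) = [forall i, t < Y i].
Proof.
apply/bigmin_gtP/forallP => [[_ H] i|H]; first exact: H.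
by split=> [|i _]; exact: H.
Qed.

Lemma min_family_ge0 (R : realType) (M : nat) (hM : (0 < M)%N) (Y : 'I_M -> R) :
  (forall i, 0 <= Y i) -> 0 <= min_family hM Y.
Proof. by move=> Y0; apply/bigmin_geP; split=> [|i _]; exact: Y0. Qed.

(** Independence of the coordinates: the sample space and the event that all
    the rho lengths are large are both products over i. *)
Lemma unif_expect_lt_min (R : realType) (M n : nat) (hM : (0 < M)%N)
    (d : 'I_M -> nat) (lambda : 'I_M -> R) (t : R) :
  (0 < n)%N -> (forall i, (0 < d i)%N) -> (forall i, (d i %| n)%N) ->
  (forall i, 0 < lambda i) -> 0 <= t ->
  unif_expect (Omega n d) (fun w => (t < min_family hM (fun i => Xvar lambda i w))%R%:R)
  = \prod_(i < M) survival R n (d i) (Num.truncn (t / lambda i)).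
Proof.
move=> n0 d0 dn l0 t0.
have F0 i : (n * #|Fnd n (d i)|)%:R != 0 :> R.
  by rewrite pnatr_eq0 -lt0n muln_gt0 n0 card_Fnd_gt0.
have cardO : #|Omega n d| = (\prod_i (n * #|Fnd n (d i)|))%N.
  rewrite (card_ffun_forall (fun i (p : 'I_n * {ffun 'I_n -> 'I_n}) =>
    p.2 \in Fnd n (d i))).
  apply: eq_bigr => i _.
  rewrite -[X in (X * _)%N](card_ord n) -cardsT -cardsX.
  by apply: eq_card => -[x f]; rewrite [LHS]unfold_in finset.in_setX finset.in_setT.
rewrite /unif_expect.
have -> : \sum_(w in Omega n d) (t < min_family hM (fun i => Xvar lambda i w))%R%:R =
    #|[set w : {ffun 'I_M -> 'I_n * {ffun 'I_n -> 'I_n}} | [forall i,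
        ((w i).2 \in Fnd n (d i)) &&
          (Num.truncn (t / lambda i) < rho (w i).2 (w i).1)%N]]%SET|%:R :> R.
  rewrite -sum1_card natr_sum big_mkcond [RHS]big_mkcond; apply: eq_bigr => w _.
  rewrite lt_min_family !inE.
  have gtE i : (t < Xvar lambda i w) =
      (Num.truncn (t / lambda i) < rho (w i).2 (w i).1)%N.
    rewrite truncn_lt_nat ?divr_ge0 ?(ltW (l0 i))// ltr_pdivrMr// mulrC.
    by rewrite /Xvar.
  rewrite (eq_forallb gtE) (_ : [forall i, _ && _] =
      [forall i, (w i).2 \in Fnd n (d i)] &&
      [forall i, (Num.truncn (t / lambda i) < rho (w i).2 (w i).1)%N]).
    by case: ifP => //= _; case: ifP.
  apply/forallP/andP => [H|[/forallP F /forallP lt] i]; last by rewrite F lt.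
  by split; apply/forallP => i; have /andP[] := H i.
rewrite (card_ffun_forall (fun i (p : 'I_n * {ffun 'I_n -> 'I_n}) =>
  (p.2 \in Fnd n (d i)) && (Num.truncn (t / lambda i) < rho p.2 p.1)%N)).
rewrite cardO !natr_prod -prodf_div; apply: eq_bigr => i _.
by rewrite -cardsE card_rho_gt_survival// mulfK.
Qed.

Lemma unif_expectZr (R : realType) (T : finType) (A : {set T}) (X : T -> R) (c : R) :
  unif_expect A (fun w => X w * c) = unif_expect A X * c.
Proof. by rewrite /unif_expect -mulr_suml mulrAC. Qed.

Lemma measurable_unif_expect_lt (R : realType) (T : finType) (A : {set T}) (X : T -> R) :
  measurable_fun [set: R] (EFin \o (fun v : R => unif_expect A (fun w => (v < X w)%R%:R : R))).
Proof.
apply/measurable_EFinP; rewrite /unif_expect; apply: measurable_funM => //.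
rewrite (_ : (fun v => _) = fun v => \sum_(w <- enum A) (v < X w)%R%:R); last first.
  by apply/funext => v; rewrite big_enum.
by apply: measurable_sum => w; exact: measurable_indicator_lt.
Qed.

(** * Convergence of the rescaled minimum *)

Section scaled_minimum.
Variables (R : realType) (M : nat) (hM : (0 < M)%N) (d : 'I_M -> nat).
Hypotheses (d_gt0 : forall i, (0 < d i)%N) (d_gt1 : exists i, (1 < d i)%N).
Variables (lambda : 'I_M -> R).
Hypothesis lambda_gt0 : forall i, 0 < lambda i.

(** The minimum divided by sqrt n has limiting tail exp (- hazard u^2 / 2), so
    that hazard * u is its limiting hazard rate. *)
Definition hazard : R := \sum_(i < M) ((d i)%:R - 1) / lambda i ^+ 2.

Definition admissible (n : nat) := (1 <= n)%N && [forall i, (d i %| n)%N].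

Definition mean_min (n : nat) : R :=
  unif_expect (Omega n d) (fun w => min_family hM (fun i => Xvar lambda i w)).

(** The unit, relative to sqrt n, in which the limiting tail is exp (- v^2). *)
Definition scale : R := Num.sqrt (2 / hazard).

Definition min_tail (n : nat) (v : R) : R :=
  unif_expect (Omega n d) (fun w =>
    (v < min_family hM (fun i => Xvar lambda i w) / (scale * Num.sqrt n%:R))%R%:R).

Lemma hazard_gt0 : 0 < hazard.
Proof.
have term_ge0 i : 0 <= ((d i)%:R - 1) / lambda i ^+ 2.
  by rewrite divr_ge0 ?exprn_ge0 ?(ltW (lambda_gt0 i))// subr_ge0 ler1n.
have [i di] := d_gt1; rewrite /hazard (bigD1 i)//= ltr_wpDr ?sumr_ge0//.
by rewrite divr_gt0 ?exprn_gt0// subr_gt0 ltr1n.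
Qed.

Lemma scale_gt0 : 0 < scale.
Proof. by rewrite sqrtr_gt0 divr_gt0 ?hazard_gt0. Qed.

Lemma min_tailE (n : nat) (v : R) : admissible n -> 0 <= v ->
  min_tail n v = \prod_(i < M)
    survival R n (d i) (Num.truncn (v * scale / lambda i * Num.sqrt n%:R)).
Proof.
move=> /andP[n0 /forallP dn] v0.
have N0 : 0 < scale * Num.sqrt n%:R by rewrite mulr_gt0 ?scale_gt0// sqrtr_gt0 ltr0n.
transitivity (\prod_(i < M)
    survival R n (d i) (Num.truncn (v * (scale * Num.sqrt n%:R) / lambda i))); last first.
  by apply: eq_bigr => i _; congr (survival _ _ _ (Num.truncn _)); ring.
rewrite -(unif_expect_lt_min hM)//; last by rewrite mulr_ge0// ltW.
rewrite /min_tail /unif_expect; congr (_ / _); apply: eq_bigr => w _.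
by rewrite ltr_pdivlMr.
Qed.

Lemma min_tail_dominated : exists a b : R, 0 < b /\
  forall n v, admissible n -> 0 <= v -> min_tail n v <= expR (a - b * v ^+ 2).
Proof.
have [i di] := d_gt1; exists (5 / 4), ((scale / lambda i) ^+ 2 / 4); split.
  by rewrite divr_gt0// exprn_gt0// divr_gt0 ?scale_gt0.
move=> n v na v0; rewrite min_tailE//; have /andP[n0 _] := na.
have w0 j : 0 <= v * scale / lambda j.
  by rewrite divr_ge0 ?mulr_ge0 ?(ltW (lambda_gt0 j)) ?(ltW scale_gt0).
rewrite (bigD1 i)//= -[leRHS]mulr1 ler_pM ?survival_ge0 ?prodr_ge0//.
- by move=> j _; exact: survival_ge0.
- apply: le_trans (survival_dominated di n0 (w0 i)) _.
  rewrite ler_expR lerD2l lerN2 le_eqVlt; apply/orP; left; apply/eqP.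
  by rewrite !exprMn; ring.
apply: prodr_ile1 => j _; rewrite survival_ge0/=; exact: survival_le1 (d_gt0 j) n0.
Qed.

(** Stated for the product formula, which makes sense for every n; it is the
    tail of the minimum for admissible n by [min_tailE]. *)
Lemma min_tail_cvg (v : R) : 0 <= v ->
  (\prod_(i < M) survival R n (d i) (Num.truncn (v * scale / lambda i * Num.sqrt n%:R)))
    @[n --> \oo] --> gauss_fun v.
Proof.
move=> v0; have -> : gauss_fun v =
    \prod_(i < M) expR (- (((d i)%:R - 1) * (v * scale / lambda i) ^+ 2 / 2)).
  rewrite -expR_sum /gauss_fun; congr expR.
  transitivity (- (\sum_(i < M) ((d i)%:R - 1) / lambda i ^+ 2) * (v ^+ 2 * scale ^+ 2 / 2)).
    rewrite -/hazard sqr_sqrtr ?divr_ge0 ?(ltW hazard_gt0)//.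
    by field; rewrite lt0r_neq0 ?hazard_gt0.
  rewrite mulNr big_distrl -sumrN; apply: eq_bigr => i _ /=.
  by field; rewrite lt0r_neq0.
apply: (cvg_big (@mul_continuous _)) => i _; apply: survival_cvg => //.
by rewrite divr_ge0 ?mulr_ge0 ?(ltW (lambda_gt0 i)) ?(ltW scale_gt0).
Qed.

Lemma min_tail_ge0 (n : nat) (v : R) : 0 <= min_tail n v.
Proof. by rewrite divr_ge0// sumr_ge0. Qed.

Lemma integral_min_tail (n : nat) :
  (\int[lebesgue_measure]_(v in `[0%R, +oo[) (min_tail n v)%:E
   = (mean_min n / (scale * Num.sqrt n%:R))%:E)%E.
Proof.
rewrite unif_expect_layer_cake ?unif_expectZr// => w.
rewrite divr_ge0 ?mulr_ge0 ?(ltW scale_gt0) ?sqrtr_ge0//; apply: min_family_ge0 => i.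
by rewrite mulr_ge0 ?(ltW (lambda_gt0 i)).
Qed.

Lemma mean_min_cvg :
  mean_min n / (scale * Num.sqrt n%:R)
    @[n --> within [set n | admissible n] \oo] --> Num.sqrt pi / 2.
Proof.
(* Putting the limit itself in place of the tail when n is not admissible
   gives a sequence that converges along all integers. *)
pose f n v := if admissible n then min_tail n v else gauss_fun v.
have [a [b [b0 min_tail_le]]] := min_tail_dominated.
pose D := `[0%R, +oo[%classic : set R.
have mD : measurable D by exact: measurable_itv.
have mgauss : measurable_fun D (EFin \o @gauss_fun R).
  by apply/measurable_EFinP; apply: measurable_funS (@measurable_gauss_fun R).
have mf n : measurable_fun D (EFin \o f n).
  rewrite /f; case: (admissible n) => //.
  exact: measurable_funS (measurable_unif_expect_lt _ _).
have f_cvg v : D v -> (f n v)%:E @[n --> \oo] --> (gauss_fun v)%:E.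
  rewrite /D /= in_itv /= andbT => v0.
  apply: cvg_EFin; first by near=> n.
  apply/cvgrPdist_lt => e e0; near=> n.
  rewrite /= /f; have [na|na] := boolP (admissible n).
    rewrite min_tailE//.
    near: n; move: e e0; apply/cvgrPdist_lt; exact: min_tail_cvg.
  by rewrite subrr normr0.
have int_dom : lebesgue_measure.-integrable D
    (fun v => (expR (a - b * v ^+ 2))%:E + (gauss_fun v)%:E)%E.
  apply: (@integrableS _ _ _ _ setT) => //.
  by apply: integrableD => //; [exact: integrable_gaussian|exact: integrableT_gauss].
have f_dom n v : D v -> (`|(f n v)%:E| <= (expR (a - b * v ^+ 2))%:E + (gauss_fun v)%:E)%E.
  rewrite /D /= in_itv /= andbT => v0; rewrite lee_fin /f.
  have [na|_] := boolP (admissible n); last first.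
    by rewrite ger0_norm ?gauss_fun_ge0// lerDr expR_ge0.
  by rewrite ger0_norm ?min_tail_ge0// ler_wpDr ?gauss_fun_ge0// min_tail_le.
have [||_ _] := @dominated_convergence _ _ R (@lebesgue_measure R) D mD
  (fun n => EFin \o f n) (EFin \o @gauss_fun R) _ mf mgauss _ int_dom.
- by apply: aeW => v; exact: f_cvg.
- by apply: aeW => v n; exact: f_dom.
rewrite integral0y_gauss => int_cvg.
have {}int_cvg : fine (\int[lebesgue_measure]_(v in D) (f n v)%:E)%E @[n --> \oo]
    --> Num.sqrt (pi : R) / 2 by exact: fine_cvg int_cvg.
apply: cvg_trans (cvg_within_filter _ int_cvg); apply: near_eq_cvg.
near=> n.
have na : admissible n by near: n; exact: withinT.
by rewrite /f na integral_min_tail.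
Unshelve. all: by end_near. Qed.

End scaled_minimum.

Theorem theorem1 (R : realType) (M : nat) (hM : (0 < M)%N)
    (d : 'I_M -> nat) (hd : forall i : 'I_M, (1 <= d i)%N)
    (hd2 : exists i : 'I_M, (2 <= d i)%N)
    (lambda : 'I_M -> R) (hlambda : forall i : 'I_M, 0 < lambda i) :
  (unif_expect (Omega n d)
     (fun w => min_family hM (fun i : 'I_M => Xvar lambda i w))
   / (Num.sqrt (pi * n%:R / 2)
      * (\sum_(i < M) ((d i)%:R - 1) / lambda i ^+ 2) `^ (- (1 / 2))))
    @[n --> within [set n : nat | (1 <= n)%N /\ forall i : 'I_M, (d i %| n)%N]
              \oo]
  --> (1 : R).
Proof.
have a0 := hazard_gt0 hd hd2 hlambda.
have pi0 : 0 < Num.sqrt (pi : R) by rewrite sqrtr_gt0 pi_gt0.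
(* What remains is that scale * sqrt n * (sqrt pi / 2) is the denominator. *)
have := cvgM (mean_min_cvg hM hd hd2 hlambda) (cvg_cst (2 / Num.sqrt (pi : R))).
rewrite mulrA divfK// divff ?lt0r_neq0// => H.
rewrite (_ : [set n | _] = [set n | admissible d n]); last first.
  by apply/seteqP; split=> n /=; [move=> [n1 dn]; apply/andP; split=> //; exact/forallP
    |move=> /andP[n1 /forallP]].
apply: (cvg_trans _ (H _ _)); apply: near_eq_cvg; near=> n.
have /andP[n1 _] : admissible d n by near: n; exact: withinT.
have n0 : 0 < Num.sqrt n%:R :> R by rewrite sqrtr_gt0 ltr0n.
have s2 : 0 < Num.sqrt 2 :> R by rewrite sqrtr_gt0.
have sa : 0 < Num.sqrt (hazard d lambda) by rewrite sqrtr_gt0.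
rewrite /= -/(hazard d lambda) -/(mean_min hM d lambda n) -[LHS]mulrA; congr (_ * _).
rewrite div1r powRN powR12_sqrt ?(ltW a0)// /scale.
rewrite !sqrtrM ?mulr_ge0 ?pi_ge0// !sqrtrV ?(ltW a0)//.
rewrite -[X in X / Num.sqrt pi](@sqr_sqrtr R 2)//.
field; rewrite !lt0r_neq0//.
Unshelve. all: by end_near. Qed.
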